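(* Let $X$ be a real-valued random variable, let $Z\sim\mathcal{N}(0,1)$ be independent of $X$, and set $Y=X+Z$. Let $p\ge 1$. Then $$\min_{a\in\mathbb{R}}\mathbb{E}\big[|X-aY|^p\big]=\min_{a\in[0,1)}\mathbb{E}\big[|X-aY|^p\big].$$
   Formalization: The additional assumption E|X|^p < ∞ is made; without it the claim fails, since then E|X-aY|^p is infinite for every a ≠ 1 but finite at a = 1 (e.g. X Cauchy, p = 1). *)

(* Defs.v *)
From HB Require Import structures.
From mathcomp Require Import all_boot all_order all_algebra.
From mathcomp Require Import all_classical all_reals all_analysis.
Set Implicit Arguments. Unset Strict Implicit. Unset Printing Implicit Defensive.
Import Order.TTheory GRing.Theory Num.Theory.
Local Open Scope classical_set_scope.
Local Open Scope ring_scope.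

Definition independent_RV {d} {T : measurableType d} {R : realType}
  (P : probability T R) (X Z : {RV P >-> R}) : Prop :=
  forall A B : set R, measurable A -> measurable B ->
    P (X @^-1` A `&` Z @^-1` B) = (P (X @^-1` A) * P (Z @^-1` B))%E.

Definition std_normal_RV {d} {T : measurableType d} {R : realType}
  (P : probability T R) (Z : {RV P >-> R}) : Prop :=
  forall B : set R, measurable B -> P (Z @^-1` B) = normal_prob 0 1 B.

Definition moment_err {d} {T : measurableType d} {R : realType}
  (P : probability T R) (X Z : {RV P >-> R}) (p a : R) : \bar R :=
  (\int[P]_w ((`| X w - a * (X w + Z w) | `^ p)%:E))%E.
Arguments independent_RV {d T R} P X Z.
Arguments std_normal_RV {d T R} P Z.
Arguments moment_err {d T R} P X Z p a.

(* Main.v *)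
(** Write [f a] for the error, i.e. [E|(1 - a) X - a Z|^p].  As [(X, Z)] and
    [(X, - Z)] have the same law, [f a] is also the mean of
    [(|(1 - a) X - a Z|^p + |(1 - a) X + a Z|^p) / 2], which by convexity is at
    least [|1 - a|^p f 0] and at least [|a|^p f 1].  So a minimizer over [[0, 1]],
    which exists by continuity, is a minimizer over the real line.  It is not [1]:
    for [t > 0] and [a = 1 / (1 + t)], [f a = (1 + t)^-p E|t X - Z|^p], and the
    symmetrized [E|t X - Z|^p] is [f 1 + o(t)], so that [f a < f 1] for some
    small [t].  If [f 1] is infinite then [f a] is infinite for all [a <> 0], so the
    moments of the normal law are never computed. *)
Require Import Defs.
From HB Require Import structures.
From mathcomp Require Import all_boot all_order all_algebra.
From mathcomp Require Import all_classical all_reals all_analysis.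
From mathcomp Require Import measurable_realfun ring lra.
Set Implicit Arguments. Unset Strict Implicit. Unset Printing Implicit Defensive.
Import Order.TTheory GRing.Theory Num.Theory.
Import numFieldNormedType.Exports.
Local Open Scope classical_set_scope.
Local Open Scope ring_scope.

(** * The centred normal law: symmetry and absence of atoms *)

(** The density is even and Lebesgue measure is invariant under negation, so a change of variables
    suffices. *)
Lemma normal_prob_preimageN (R : realType) (s : R) (B : set R) :
  s != 0 -> measurable B -> normal_prob 0 s (-%R @^-1` B) = normal_prob 0 s B.
Proof.
move=> s0 mB; rewrite /normal_prob.
have mN : measurable_fun [set: measurableTypeR R]
  (-%R : measurableTypeR R -> measurableTypeR R) by exact: oppr_measurable.
rewrite [RHS](eq_measure_integral (pushforward lebesgue_measure
    (-%R : measurableTypeR R -> measurableTypeR R))); last first.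
  by move=> A mA _; rewrite -[LHS]lebesgue_measureN.
rewrite ge0_integral_pushforward//; last 2 first.
- by apply/measurable_EFinP/measurable_funTS; exact: measurable_normal_pdf.
- by move=> x _; rewrite lee_fin normal_pdf_ge0.
apply: eq_integral => x _ /=; congr (_%:E).
by rewrite !normal_pdfE// /normal_fun !subr0 sqrrN.
Qed.

Lemma normal_prob_set1 (R : realType) (m s x : R) :
  normal_prob m s [set x] = 0%E.
Proof.
have /null_content_dominatesP := normal_prob_dominates m s.
by apply; [exact: measurable_set1 | exact: lebesgue_measure_set1].
Qed.

(** * Convexity inequalities for the [p]-th power of the absolute value, and its symmetric
    difference quotient *)

Lemma convex_normr_powR (R : realType) (p t u v : R) : 1 <= p -> 0 <= t <= 1 ->
  `|t * u + (1 - t) * v| `^ p <= t * `|u| `^ p + (1 - t) * `|v| `^ p.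
Proof.
move=> p1 /andP[t0 t1].
apply: (@le_trans _ _ ((t * `|u| + (1 - t) * `|v|) `^ p)).
  rewrite ge0_ler_powR ?nnegrE ?(le_trans _ p1)//.
    by rewrite addr_ge0// mulr_ge0// subr_ge0.
  rewrite (le_trans (ler_normD _ _))// !normrM (ger0_norm t0).
  by rewrite (@ger0_norm _ (1 - t)) ?subr_ge0.
by apply: (convex_powR p1 (Itv01 t0 t1)); rewrite inE/= in_itv/= normr_ge0.
Qed.

(** Convexity at the midpoint: [v] is halfway between [u + v] and [- (u - v)]. *)
Lemma parallelogram_powR (R : realType) (p u v : R) : 1 <= p ->
  `|v| `^ p *+ 2 <= `|u - v| `^ p + `|u + v| `^ p.
Proof.
move=> p1.
have h : 0 <= (2^-1 : R) <= 1 by rewrite invr_ge0 invf_le1 ?ler0n ?ler1n.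
have := convex_normr_powR (u + v) (- (u - v)) p1 h.
rewrite normrN (_ : _ * (u + v) + _ = v); first by lra.
by field.
Qed.

(** Here [u + v] is the midpoint of [2 * u] and [2 * v]. The constant is not sharp; it only serves
    for domination. *)
Lemma normrD_powR_le (R : realType) (p u v : R) : 1 <= p ->
  `|u + v| `^ p <= 2 `^ p * (`|u| `^ p + `|v| `^ p).
Proof.
move=> p1.
have h : 0 <= (2^-1 : R) <= 1 by rewrite invr_ge0 invf_le1 ?ler0n ?ler1n.
have := convex_normr_powR (2 * u) (2 * v) p1 h.
rewrite (_ : _ * (2 * u) + _ = u + v); last by field.
move/le_trans; apply.
rewrite !normrM !powRM// ger0_norm//.
have := powR_ge0 2 p; have := powR_ge0 `|u| p; have := powR_ge0 `|v| p.
move: (_ `^ _) (_ `^ _) (_ `^ _) => a b c; nra.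
Qed.

(* The quotient is that of an even function of [t], so it tends to a zero derivative. *)
Lemma cvg_sym_quotient (R : realType) (p x z : R) : z != 0 ->
  t^-1 * ((`|t * x - z| `^ p + `|t * x + z| `^ p) / 2 - `|z| `^ p) @[t --> 0^'] --> 0.
Proof.
wlog z0 : z / 0 < z.
  move=> hw; case: (ltgtP 0 z) => // z0 _; first by apply: hw => //; rewrite gt_eqF.
  have := hw (- z); rewrite oppr_gt0 oppr_eq0 lt_eqF// normrN opprK => /(_ z0 isT).
  by under eq_fun do rewrite [X in X / 2]addrC.
move=> _.
have dl a : is_derive (0 : R) 1 (fun t : R => z + t * a) a.
  by apply: is_derive_eq; rewrite /GRing.scale/=; ring.
have dp a : is_derive (0 : R) 1 (fun t : R => (z + t * a) `^ p) (p * z `^ (p - 1) * a).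
  have := @is_derive1_comp _ (@powR R ^~ p) (fun t => z + t * a) 0 _ _ _ (dl a).
  by rewrite mul0r addr0; apply; exact: is_derive1_powR.
(* Near [t = 0], where [t * x] is smaller than [z] in absolute value, [g] is the symmetrized power
   with the absolute values removed. The slopes of its two terms at [0] are opposite and cancel. *)
pose g : R -> R := 2^-1 \*: ((fun t : R => (z + t * (- x)) `^ p) +
                 (fun t : R => (z + t * x) `^ p)).
have dg : is_derive (0 : R) 1 g 0.
  apply: is_derive_eq; rewrite /GRing.scale/=; ring.
have : h^-1 *: ((g \o shift 0) (h *: 1) - g 0) @[h --> 0^'] --> 'D_1 g 0.
  exact: ex_derive.
rewrite derive_val; apply: cvg_trans; apply: near_eq_cvg; near=> t.
have tx : `|t * x| < z.
  near: t; apply: cvgr0_norm_lt => //.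
  rewrite -[X in _ --> X](mul0r x); apply: cvgM; last exact: cvg_cst.
  exact: cvg_within.
rewrite /g/= /GRing.scale/= !fctE/= !mul0r !mulr1 !addr0 (gtr0_norm z0).
move: tx; rewrite ltr_norml => /andP[tx1 tx2].
rewrite ltr0_norm; last by lra.
rewrite (@gtr0_norm _ (_ + z)); last by lra.
rewrite mulrN opprB addrC.
have -> : t * x + z = z + t * x by ring.
congr (_ * _); set a := _ `^ p; set b := _ `^ p; set c := _ `^ p; lra.
Unshelve. all: by end_near. Qed.

(** * Symmetrization in [Z], and the lower bounds it gives *)

Lemma ge0_integral_pairN d (T : measurableType d) (R : realType)
    (P : probability T R) (X Z : {RV P >-> R}) (h : R * R -> \bar R) :
  std_normal_RV P Z -> independent_RV P X Z ->
  measurable_fun [set: R * R] h -> (forall xz, 0 <= h xz)%E ->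
  (\int[P]_w h (X w, (- Z w)%R) = \int[P]_w h (X w, Z w))%E.
Proof.
move=> nZ iXZ mh h0.
have mXZ : measurable_fun [set: T] (fun w => (X w, Z w)).
  exact: measurable_fun_pair.
have mXN : measurable_fun [set: T] (fun w => (X w, - Z w)).
  by apply: measurable_fun_pair => //; exact: measurableT_comp.
pose XZ : {mfun T >-> (R * R)%type} := HB.pack (fun w => (X w, Z w))
  (isMeasurableFun.Build _ _ _ _ _ mXZ).
pose XN : {mfun T >-> (R * R)%type} := HB.pack (fun w => (X w, - Z w))
  (isMeasurableFun.Build _ _ _ _ _ mXN).
rewrite -[LHS](@ge0_integral_distribution _ _ _ _ _ P XN h)//.
rewrite -[RHS](@ge0_integral_distribution _ _ _ _ _ P XZ h)//.
apply: eq_measure_integral => A mA _.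
(* By independence both joint laws agree on rectangles with the product of the laws of [X] and [Z],
   hence equal it; for [- Z] this uses the symmetry of the normal law. *)
pose m := @product_measure_unique _ _ _ _ R (distribution P X) (distribution P Z).
rewrite -(m (distribution P XZ))//.
rewrite -(m (distribution P XN))// => B C mB mC.
have mNC : measurable (-%R @^-1` C).
  by rewrite -[X in measurable X]setTI; exact: oppr_measurable.
transitivity (P (X @^-1` B) * P (Z @^-1` (-%R @^-1` C)))%E.
  by rewrite -iXZ.
congr (_ * _)%E; rewrite nZ// normal_prob_preimageN ?oner_neq0//.
exact/esym/nZ.
Qed.

Lemma measurable_normr_powR d (T : measurableType d) (R : realType) (p : R) (f : T -> R) :
  measurable_fun [set: T] f ->
  measurable_fun [set: T] (fun w => (`|f w| `^ p)%:E).
Proof.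
move=> mf; apply/measurable_EFinP; apply: (measurableT_comp (measurable_powR p)).
exact: measurableT_comp.
Qed.

Lemma ge0_integral_sym d (T : measurableType d) (R : realType)
    (P : probability T R) (X Z : {RV P >-> R}) (p u v : R) :
  std_normal_RV P Z -> independent_RV P X Z ->
  (\int[P]_w (`|u * X w - v * Z w| `^ p)%:E =
   \int[P]_w ((`|u * X w - v * Z w| `^ p + `|u * X w + v * Z w| `^ p) / 2)%:E)%E.
Proof.
move=> nZ iXZ.
have mu : measurable_fun [set: T] (fun w => u * X w) by exact: measurable_funM.
have mv : measurable_fun [set: T] (fun w => v * Z w) by exact: measurable_funM.
have mA := measurable_normr_powR p (measurable_funB mu mv).
have mB := measurable_normr_powR p (measurable_funD mu mv).
have AB : (\int[P]_w (`|u * X w - v * Z w| `^ p)%:E =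
           \int[P]_w (`|u * X w + v * Z w| `^ p)%:E)%E.
  pose h (xz : R * R) := (`|u * xz.1 + v * xz.2| `^ p)%:E.
  transitivity (\int[P]_w h (X w, (- Z w)%R))%E.
    by apply: eq_integral => w _; rewrite /h/= mulrN.
  rewrite (ge0_integral_pairN (h := h))//; last by move=> xz; rewrite lee_fin powR_ge0.
  by apply: measurable_normr_powR; apply: measurable_funD; exact: measurable_funM.
under [RHS]eq_integral do rewrite mulrC mulrDr EFinD !EFinM.
have ge0 : (0 <= (2^-1 : R)%:E)%E by rewrite lee_fin invr_ge0.
rewrite ge0_integralD//.
- have half : 2^-1 + 2^-1 = 1 :> R by field.
  rewrite !ge0_integralZl//; try by move=> w _; rewrite lee_fin powR_ge0.
  by rewrite -AB -ge0_muleDl// -EFinD half mul1e.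
- exact: measurable_funeM.
- exact: measurable_funeM.
Qed.

Lemma ge0_integral_powRZ d (T : measurableType d) (R : realType)
    (mu : {measure set T -> \bar R}) (f : T -> R) (p u : R) :
  measurable_fun [set: T] f ->
  (\int[mu]_w (`|u * f w| `^ p)%:E = (`|u| `^ p)%:E * \int[mu]_w (`|f w| `^ p)%:E)%E.
Proof.
move=> mf; rewrite -ge0_integralZl//.
- by apply: eq_integral => w _; rewrite normrM powRM// EFinM.
- exact: measurable_normr_powR.
Qed.

(** After symmetrization both bounds hold pointwise, by [parallelogram_powR]. *)
Lemma integral_powR_ge d (T : measurableType d) (R : realType)
    (P : probability T R) (X Z : {RV P >-> R}) (p u v : R) :
  1 <= p -> std_normal_RV P Z -> independent_RV P X Z ->
  ((`|u| `^ p)%:E * \int[P]_w (`|X w| `^ p)%:E <=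
     \int[P]_w (`|u * X w - v * Z w| `^ p)%:E)%E /\
  ((`|v| `^ p)%:E * \int[P]_w (`|Z w| `^ p)%:E <=
     \int[P]_w (`|u * X w - v * Z w| `^ p)%:E)%E.
Proof.
move=> p1 nZ iXZ; rewrite -!ge0_integral_powRZ// ge0_integral_sym//.
have mu : measurable_fun [set: T] (fun w => u * X w) by exact: measurable_funM.
have mv : measurable_fun [set: T] (fun w => v * Z w) by exact: measurable_funM.
have mA := measurable_normr_powR p (measurable_funB mu mv).
have mB := measurable_normr_powR p (measurable_funD mu mv).
have mAB : measurable_fun [set: T] (fun w =>
    ((`|u * X w - v * Z w| `^ p + `|u * X w + v * Z w| `^ p) / 2)%:E).
  apply/measurable_EFinP; apply: measurable_funM => //.
  by apply: measurable_funD; apply/measurable_EFinP.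
have le_half (a b : R) : a *+ 2 <= b -> a <= b / 2 by lra.
split; apply: ge0_le_integral => //.
- exact: measurable_normr_powR.
(* Exchanging the roles of [u * X w] and [v * Z w] leaves the symmetrized integrand unchanged. *)
- move=> w _; rewrite lee_fin; apply: le_half.
  by rewrite distrC [u * X w + _]addrC; exact: parallelogram_powR.
- exact: measurable_normr_powR.
- by move=> w _; rewrite lee_fin; apply: le_half; exact: parallelogram_powR.
Qed.

(** * Integrability, continuity and domination *)

Lemma integrable_powRD d (T : measurableType d) (R : realType)
    (P : probability T R) (X Z : {RV P >-> R}) (p u v : R) : 1 <= p ->
  P.-integrable [set: T] (fun w => (`|X w| `^ p)%:E) ->
  P.-integrable [set: T] (fun w => (`|Z w| `^ p)%:E) ->
  P.-integrable [set: T] (fun w => (`|u * X w + v * Z w| `^ p)%:E).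
Proof.
move=> p1 iX iZ.
have := integrableZl measurableT (2 `^ p) (integrableD measurableT
  (integrableZl measurableT (`|u| `^ p) iX) (integrableZl measurableT (`|v| `^ p) iZ)).
apply: le_integrable => //.
  by apply: measurable_normr_powR; apply: measurable_funD; exact: measurable_funM.
move=> w _ /=; rewrite lee_fin (ger0_norm (powR_ge0 _ _)).
rewrite (le_trans _ (ler_norm _))// -!powRM// -!normrM.
exact: normrD_powR_le.
Qed.

Lemma integrable_normr_powR d (T : measurableType d) (R : realType)
    (P : probability T R) (X : {RV P >-> R}) (p : R) :
  (\int[P]_w (`|X w| `^ p)%:E < +oo)%E ->
  P.-integrable [set: T] (fun w => (`|X w| `^ p)%:E).
Proof.
move=> Xoo; apply/integrableP; split; first exact: measurable_normr_powR.
by under eq_integral do rewrite gee0_abs ?lee_fin ?powR_ge0//.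
Qed.

Lemma continuous_normr_powR (R : realType) (p : R) : 1 <= p ->
  continuous (fun x : R => `|x| `^ p).
Proof.
move=> p1 x; have [->|x0] := eqVneq x 0.
  have f0 : `|0 : R| `^ p = 0 by rewrite normr0 powR0 ?gt_eqF ?(lt_le_trans _ p1).
  rewrite /continuous_at f0.
  apply/cvgr0Pnorm_lt => e e0; near=> y.
  have y1 : `|y| < 1 by near: y; apply: cvgr0_norm_lt => //; exact: cvg_id.
  have ye : `|y| < e by near: y; apply: cvgr0_norm_lt => //; exact: cvg_id.
  (* At the origin, [p >= 1] makes the power at most [|y|] once [|y| < 1]. *)
  rewrite ger0_norm ?powR_ge0// (le_lt_trans _ ye)//.
  have [->|y0] := eqVneq y 0; first by rewrite normr0 powR0 ?gt_eqF ?(lt_le_trans _ p1).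
  by rewrite ge1r_powR// normr_gt0 y0 ltW.
apply: (@cvg_comp _ _ _ Num.norm (@powR R ^~ p) _ (nbhs `|x|)).
  exact: norm_continuous.
suff /derivable1_diffP/differentiable_continuous :
  derivable (@powR R ^~ p) `|x| 1 by [].
by apply: derivable_powR; rewrite in_itv/= normr_gt0 x0.
Unshelve. all: by end_near. Qed.

(** The upper bound is uniform in [t], as dominated convergence requires: [t * x - z] and
    [t * x + z] are convex combinations, with weight [t], of [x - z] and [- z], and of [x + z] and
    [z]. *)
Lemma sym_quotient_bounds (R : realType) (p t x z : R) : 1 <= p -> 0 < t <= 1 ->
  0 <= t^-1 * ((`|t * x - z| `^ p + `|t * x + z| `^ p) / 2 - `|z| `^ p)
    <= (`|x - z| `^ p + `|x + z| `^ p) / 2.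
Proof.
move=> p1 /andP[t0 t1].
have h : 0 <= t <= 1 by rewrite ltW.
have := convex_normr_powR (x - z) (- z) p1 h.
have := convex_normr_powR (x + z) z p1 h.
rewrite normrN (_ : t * (x - z) + _ = t * x - z); last by ring.
rewrite (_ : t * (x + z) + _ = t * x + z); last by ring.
have := parallelogram_powR (t * x) z p1; have := powR_ge0 `|z| p.
set a := `|_| `^ p; set b := `|_| `^ p; set c := `|_| `^ p.
set d := `|_| `^ p; set e := `|_| `^ p => a0 bc H1 H2.
rewrite mulr_ge0 ?invr_ge0 ?(ltW t0)//=; last by lra.
rewrite mulrC ler_pdivrMr//; nra.
Qed.

(** * The error as a function of [a] *)

Lemma moment_errE d (T : measurableType d) (R : realType)
    (P : probability T R) (X Z : {RV P >-> R}) (p a : R) :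
  moment_err P X Z p a = (\int[P]_w (`|(1 - a) * X w - a * Z w| `^ p)%:E)%E.
Proof.
rewrite /moment_err; apply: eq_integral => w _; congr (`|_| `^ _)%:E; ring.
Qed.

Lemma moment_err1 d (T : measurableType d) (R : realType)
    (P : probability T R) (X Z : {RV P >-> R}) (p : R) :
  moment_err P X Z p 1 = (\int[P]_w (`|Z w| `^ p)%:E)%E.
Proof.
rewrite moment_errE; apply: eq_integral => w _.
by rewrite subrr mul0r mul1r sub0r normrN.
Qed.

Lemma continuous_moment_err d (T : measurableType d) (R : realType)
    (P : probability T R) (X Z : {RV P >-> R}) (p : R) : 1 <= p ->
  P.-integrable [set: T] (fun w => (`|X w| `^ p)%:E) ->
  P.-integrable [set: T] (fun w => (`|Z w| `^ p)%:E) ->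
  {within `[0, 1], continuous (fun a => fine (moment_err P X Z p a))}.
Proof.
move=> p1 iX iZ.
pose f (a : R) w := `|X w - a * (X w + Z w)| `^ p.
(* A dominating function valid for all [a] in the open interval from [-1] to [2], which contains
   [[0, 1]]: there [|1 - a|] and [|a|] are at most [2]. The outer factor comes from
   [normrD_powR_le]. *)
pose g w := 2 `^ p * (2 `^ p * `|X w| `^ p + 2 `^ p * `|Z w| `^ p).
have p0 : 0 <= p by rewrite (le_trans _ p1).
have fE a w : f a w = `|(1 - a) * X w + (- a) * Z w| `^ p.
  by rewrite /f; congr (`|_| `^ _); ring.
apply: continuous_in_subspaceT => a; rewrite inE/= in_itv/= => /andP[a0 a1].
have H := @continuity_under_integral R d T P f [set: T] measurableT (-1) 2 _ _ g.
apply: H.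
- move=> b _; rewrite (_ : _ \o _ = fun w => (`|(1 - b) * X w + (- b) * Z w| `^ p)%:E).
    exact: integrable_powRD.
  by apply/funext => w /=; rewrite fE.
- apply: aeW => w _ b _.
  apply: (@cvg_comp _ _ _ (fun b => X w - b * (X w + Z w))
    (fun x => `|x| `^ p) _ (nbhs (X w - b * (X w + Z w)))).
    apply: cvgB; first exact: cvg_cst.
    by apply: cvgM; [exact: cvg_id | exact: cvg_cst].
  exact: continuous_normr_powR.
- exact: (integrableZl measurableT (2 `^ p) (integrableD measurableT
    (integrableZl measurableT (2 `^ p) iX) (integrableZl measurableT (2 `^ p) iZ))).
- move=> b; rewrite /= in_itv/= => /andP[b0 b1]; apply: aeW => w _.
  rewrite ger0_norm ?powR_ge0// fE /g -!powRM//.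
  apply: (le_trans (normrD_powR_le _ _ p1)).
  rewrite ler_wpM2l ?powR_ge0// lerD// normrM ge0_ler_powR ?nnegrE ?mulr_ge0//;
    rewrite ler_wpM2r// ler_norml; lra.
- by rewrite inE/= in_itv/=; lra.
Qed.

(** * Strict improvement on [a = 1] *)

(** A zero integral would force [Z = 0] almost surely, while the normal law has no atom at [0]; two
    null sets would then cover the whole space. *)
Lemma integral_normal_powR_gt0 d (T : measurableType d) (R : realType)
    (P : probability T R) (Z : {RV P >-> R}) (p : R) : std_normal_RV P Z ->
  (0 < \int[P]_w (`|Z w| `^ p)%:E)%E.
Proof.
move=> nZ; rewrite lt_neqAle integral_ge0 ?andbT; last first.
  by move=> w _; rewrite lee_fin powR_ge0.
apply/eqP => /esym I0.
have mZ : measurable (Z @^-1` [set 0]).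
  by rewrite -[X in measurable X]setTI; exact: (measurable_funPT Z).
have Z0 : P (Z @^-1` [set 0]) = 0%E by rewrite nZ// normal_prob_set1.
have /(ae_eq_integral_abs P measurableT (measurable_normr_powR p (measurable_funPT Z))) :
    (\int[P]_w `|(`|Z w| `^ p)%:E| = 0)%E.
  by rewrite -I0; apply: eq_integral => w _; rewrite gee0_abs// lee_fin powR_ge0.
move=> [N [mN N0 sN]].
have PN : P (N `|` Z @^-1` [set 0%R]) = 0%E by rewrite measureU0.
suff : (1 <= 0 :> \bar R)%E by rewrite lee_fin ler10.
rewrite -(probability_setT P) -PN.
apply: le_measure; rewrite ?inE//; first exact: measurableU.
move=> w _; case: (pselect (Z w = 0)) => [Zw|Zw]; [by right|left].
by apply: sN => /= /(_ I) [] /eqP; rewrite powR_eq0 normr_eq0 => /andP[/eqP /Zw].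
Qed.

Lemma moment_err_lt1 d (T : measurableType d) (R : realType)
    (P : probability T R) (X Z : {RV P >-> R}) (p : R) : 1 <= p ->
  std_normal_RV P Z -> independent_RV P X Z ->
  P.-integrable [set: T] (fun w => (`|X w| `^ p)%:E) ->
  P.-integrable [set: T] (fun w => (`|Z w| `^ p)%:E) ->
  exists2 a : R, 0 <= a < 1 & (moment_err P X Z p a < moment_err P X Z p 1)%E.
Proof.
move=> p1 nZ iXZ iX iZ.
set M := (\int[P]_w (`|Z w| `^ p)%:E)%E.
have M1 : moment_err P X Z p 1 = M by exact: moment_err1.
have Mgt0 : (0 < M)%E by exact: integral_normal_powR_gt0.
pose q (t x z : R) :=
  t^-1 * ((`|t * x - z| `^ p + `|t * x + z| `^ p) / 2 - `|z| `^ p).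
pose G w := (`|X w - Z w| `^ p + `|X w + Z w| `^ p) / 2.
(* A sequence of values of [t] tending to [0] inside the range [0 < t <= 1] of
   [sym_quotient_bounds]. *)
pose s n : R := harmonic n.
have s01 n : 0 < s n <= 1.
  by rewrite /s/= invr_gt0 ltr0n/= invf_le1 ?ltr0n// ler1n.
have q_bounds n w : 0 <= q (s n) (X w) (Z w) <= G w.
  exact: sym_quotient_bounds.
have mq n : measurable_fun [set: T] (fun w => (q (s n) (X w) (Z w))%:E).
  apply/measurable_EFinP; apply: measurable_funM => //.
  have mt : measurable_fun [set: T] (fun w => s n * X w) by exact: measurable_funM.
  apply: measurable_funB; last exact/measurable_EFinP/measurable_normr_powR.
  apply: measurable_funM => //; apply: measurable_funD;
    apply/measurable_EFinP/measurable_normr_powR.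
    exact: measurable_funB.
  exact: measurable_funD.
have iG : P.-integrable [set: T] (EFin \o G).
  have := integrableZl measurableT 2^-1 (integrableD measurableT
    (integrable_powRD 1 (-1) p1 iX iZ) (integrable_powRD 1 1 p1 iX iZ)).
  apply: eq_integrable => // w _.
  by rewrite /= /G -EFinM mulrC !mul1r mulN1r.
have Z0 : P (Z @^-1` [set 0]) = 0%E by rewrite nZ// normal_prob_set1.
have q_cvg0 : {ae P, forall w, [set: T] w ->
    (q (s n) (X w) (Z w))%:E @[n --> \oo] --> (cst 0%E : T -> \bar R) w}.
  (* Where [Z w = 0] the quotient is [t^(p-1) |X w|^p], which need not vanish in the limit when
     [p = 1]. *)
  exists (Z @^-1` [set 0]); split => //.
  apply/subsetCPl => w /= /eqP Zw _.
  apply: cvg_EFin; first exact: nearW.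
  have /cvgr_dnbhsP := @cvg_sym_quotient R p (X w) (Z w) Zw.
  apply; split; last exact: cvg_harmonic.
  by move=> n; have /andP[/gt_eqF ->] := s01 n.
have q_dom : {ae P, forall w n, [set: T] w ->
    (`|(q (s n) (X w) (Z w))%:E| <= (EFin \o G) w)%E}.
  apply: aeW => w n _; have /andP[q0 qG] := q_bounds n w.
  by rewrite gee0_abs ?lee_fin.
have cvgq : (\int[P]_w (q (s n) (X w) (Z w))%:E)%E @[n --> \oo] --> 0%E.
  have [_ _] := dominated_convergence measurableT mq (measurable_cst _) q_cvg0 iG q_dom.
  by rewrite integral0.
have [n qM] : exists n, (\int[P]_w (q (s n) (X w) (Z w))%:E < M)%E.
  apply: contrapT => qM; have : (M <= 0)%E; last by rewrite leNgt Mgt0.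
  apply: cvge_ge cvgq; apply: nearW => n.
  by rewrite leNgt; apply/negP => ?; apply: qM; exists n.
have /andP[t0 t1] := s01 n; set t := s n in t0 t1 qM.
have Et : (\int[P]_w (`|t * X w - 1 * Z w| `^ p)%:E =
    M + t%:E * \int[P]_w (q t (X w) (Z w))%:E)%E.
  rewrite ge0_integral_sym// -ge0_integralZl//; last 2 first.
    by move=> w _; rewrite lee_fin; have /andP[] := q_bounds n w.
    by rewrite lee_fin ltW.
  rewrite -ge0_integralD//.
  - apply: eq_integral => w _; rewrite -EFinM -EFinD /q !mul1r; congr (_%:E).
    rewrite mulrA divff ?gt_eqF// mul1r; ring.
  - exact: measurable_normr_powR.
  - by move=> w _; rewrite -EFinM lee_fin mulr_ge0 ?(ltW t0)//;
      have /andP[] := q_bounds n w.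
  - apply: measurable_funeM; exact: mq.
  - exact: mq.
have u0 : 0 < 1 + t by lra.
exists (1 + t)^-1.
  by rewrite invr_ge0 (ltW u0) invf_lt1//; lra.
have Mfin : M \is a fin_num by exact: integrable_fin_num.
rewrite M1 moment_errE.
under eq_integral.
  move=> w _.
  rewrite (_ : (1 - (1 + t)^-1) * X w - (1 + t)^-1 * Z w =
      (1 + t)^-1 * (t * X w - 1 * Z w)); last first.
    by field; rewrite gt_eqF.
  over.
rewrite ge0_integral_powRZ; last by apply: measurable_funB; exact: measurable_funM.
rewrite Et.
set I := (\int[P]_w (q t _ _)%:E)%E in qM *.
have I0 : (0 <= I)%E.
  by apply: integral_ge0 => w _; rewrite lee_fin; have /andP[] := q_bounds n w.
have Ifin : I \is a fin_num by rewrite ge0_fin_numE// (lt_trans qM)// ltey_eq Mfin.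
rewrite -(fineK Mfin) -(fineK Ifin) -(EFinM t) -EFinD -EFinM lte_fin.
have {}qM : fine I < fine M by rewrite -lte_fin !fineK.
have {}I0 : 0 <= fine I by rewrite fine_ge0.
have si : 0 < (1 + t)^-1 <= 1 by rewrite invr_gt0 u0 invf_le1//; lra.
(* Since the base lies in []0, 1]] and [p >= 1], the exponent can be replaced by [1]. *)
have sp : `|(1 + t)^-1| `^ p <= (1 + t)^-1.
  by rewrite gtr0_norm ?ge1r_powR//; case/andP: si.
apply: (@le_lt_trans _ _ ((1 + t)^-1 * (fine M + t * fine I))).
  by rewrite ler_wpM2r// addr_ge0 ?mulr_ge0//; lra.
rewrite mulrC ltr_pdivrMr//; nra.
Qed.

Theorem theorem1 (d : measure_display) (T : measurableType d) (R : realType)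
  (P : probability T R) (X Z : {RV P >-> R}) (p : R) :
  1 <= p ->
  std_normal_RV P Z ->
  independent_RV P X Z ->
  (\int[P]_w ((`| X w | `^ p)%:E) < +oo)%E ->
  (* the minimum over all a in R exists and is attained at some a0 in [0,1);
     hence min_{a in R} = min_{a in [0,1)} *)
  exists a0 : R, 0 <= a0 < 1 /\
    forall a : R, (moment_err P X Z p a0 <= moment_err P X Z p a)%E.
Proof.
move=> p1 nZ iXZ Xoo.
have f0 : moment_err P X Z p 0 = (\int[P]_w (`|X w| `^ p)%:E)%E.
  by rewrite moment_errE; apply: eq_integral => w _; rewrite subr0 mul1r mul0r subr0.
have f1 := moment_err1 X Z p.
have ge_f0 a : ((`|1 - a| `^ p)%:E * moment_err P X Z p 0 <= moment_err P X Z p a)%E.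
  by rewrite f0 moment_errE; have [] := integral_powR_ge (1 - a) a p1 nZ iXZ.
have ge_f1 a : ((`|a| `^ p)%:E * moment_err P X Z p 1 <= moment_err P X Z p a)%E.
  by rewrite f1 moment_errE; have [] := integral_powR_ge (1 - a) a p1 nZ iXZ.
have fge0 a : (0 <= moment_err P X Z p a)%E.
  by apply: integral_ge0 => w _; rewrite lee_fin powR_ge0.
have [f1oo|] := eqVneq (moment_err P X Z p 1) +oo%E.
  exists 0; split; first by rewrite lexx ltr01.
  move=> a; have [->//|a0] := eqVneq a 0.
  apply: le_trans (ge_f1 a).
  by rewrite f1oo gt0_muley ?leey// lte_fin powR_gt0// normr_gt0.
rewrite -ltey f1 => Zoo.
have iX := integrable_normr_powR Xoo; have iZ := integrable_normr_powR Zoo.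
(* Compactness gives a minimizer on the closed interval; the endpoint [1] is excluded afterwards by
   [moment_err_lt1]. *)
have [c] := EVT_min ler01 (continuous_moment_err p1 iX iZ).
rewrite in_itv/= => /andP[c0 c1] cmin.
have ffin a : moment_err P X Z p a \is a fin_num.
  rewrite moment_errE; apply: integrable_fin_num => //.
  by under eq_fun do rewrite -mulNr; exact: integrable_powRD.
have {}cmin a : 0 <= a <= 1 -> (moment_err P X Z p c <= moment_err P X Z p a)%E.
  move=> a01; rewrite -(fineK (ffin c)) -(fineK (ffin a)) lee_fin.
  by apply: cmin; rewrite in_itv.
have [b /andP[b0 b1] fb] := moment_err_lt1 p1 nZ iXZ iX iZ.
exists c; split.
  rewrite c0 lt_neqAle c1 andbT; apply/eqP => cE.
  have := cmin b; rewrite b0 ltW// cE => /(_ isT).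
  by rewrite leNgt fb.
(* Used with [r = |1 - a|] for [a < 0] and [r = |a|] for [a > 1]: outside [[0, 1]] the error is at
   least its value at the nearer endpoint. *)
have ge1M (r : R) (x : \bar R) : 1 <= r -> (0 <= x -> x <= (r `^ p)%:E * x)%E.
  move=> r1 x0; rewrite -[leLHS]mul1e lee_wpmul2r// lee_fin.
  by rewrite (le_trans r1)// le1r_powR.
move=> a; have [a0|a0] := ltP a 0.
  apply: le_trans (ge_f0 a); apply: le_trans (cmin 0 _) (ge1M _ _ _ _) => //.
    by rewrite lexx ler01.
  by rewrite ger0_norm; lra.
have [a1|a1] := leP a 1; first by apply: cmin; rewrite a0.
apply: le_trans (ge_f1 a); apply: le_trans (cmin 1 _) (ge1M _ _ _ _) => //.
  by rewrite lexx ler01.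
by rewrite ger0_norm; lra.
Qed.
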